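(* Let $\mathbf{p}=(p_i)_{i\ge1}$ with $p_1=0$, $p_2=1$, $p_i\in(0,1)$ for $i\ge3$, $q_i=1-p_i$, and let $\boldsymbol\theta=(\theta_i)_{i\ge1}$ be a sequence of strictly positive reals with $\theta_1=1$. For any $n\in\mathbb{N}$ with $n\ge 4$, the following are equivalent. (i) For any $(a_n,\dots,a_1)\in\Delta_n$, $$\mathbb{P}_{\mathbf{p}}(X_n^n=a_n,\dots,X_1^n=a_1)=\mathbb{P}_{\boldsymbol\theta}(Y_n=a_n,\dots,Y_1=a_1\mid (Y_n,\dots,Y_1)\in\Delta_n).$$ (ii) For $i=3,\dots,n-1$, $$p_i=\frac{(i-1+\theta_i)\gamma_i(\boldsymbol\theta)}{(i-1+\theta_i)\gamma_i(\boldsymbol\theta)+\theta_i\gamma_{i-1}(\boldsymbol\theta)}=\frac{G_{i-1}(\boldsymbol\theta)}{G_i(\boldsymbol\theta)}.$$ (iii) For $i=3,\dots,n-1$, $$\theta_i=\frac{(i-1)q_{i}}{p_{i}p_{i-1}}.$$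
   Context: Random derangement process: $X^{n,\mathbf{p}}=(X^n_{n+1}=1,X^n_n,\dots,X^n_1)$ is the $\{0,1\}$-valued inhomogeneous Markov chain, run in decreasing index and started from $X^n_{n+1}=1$, such that $X^n_n=0$ a.s., $X^n_1=1$ a.s., and for $2\le r\le n-1$: $\mathbb{P}(X^n_r=0\mid X^n_{r+1}=0)=p_r$, $\mathbb{P}(X^n_r=1\mid X^n_{r+1}=0)=q_r$, $\mathbb{P}(X^n_r=0\mid X^n_{r+1}=1)=1$. Generalized Feller coupling: $Y=Y^{\boldsymbol\theta}=(Y_i)_{i\ge1}$ is a sequence of independent $\{0,1\}$-valued random variables with $\mathbb{P}_{\boldsymbol\theta}(Y_i=0)=\frac{i-1}{i-1+\theta_i}$ (so $Y_1=1$ a.s.). For $j\in\mathbb{N}$, $\Delta_j=\{(a_j,\dots,a_1)\in\{0,1\}^j: a_1=1,\ a_j+\sum_{i=1}^{j-1}a_ia_{i+1}=0\}$, and $\gamma_j(\boldsymbol\theta)=\mathbb{P}_{\boldsymbol\theta}((Y_j,\dots,Y_1)\in\Delta_j)$. $G_0(\boldsymbol\theta)=0$, $G_1(\boldsymbol\theta)=G_2(\boldsymbol\theta)=1$, and for $i\ge3$, $$G_i(\boldsymbol\theta)=1+\sum_{k=1}^{\lfloor\frac{i-1}{2}\rfloor}\sum_{(i_1,\dots,i_k)}\frac{\theta_{i_1}\cdots\theta_{i_k}}{(i_1-1)\cdots(i_k-1)},$$ where the inner sum is over all $(i_1,\dots,i_k)$ with $2<i_j\le i$ and $i_{j+1}>i_j+1$.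 *)

(* Defs.v *)
From HB Require Import structures.
From mathcomp Require Import all_boot all_order all_algebra finmap.
From mathcomp Require Import all_classical all_reals all_analysis.
Set Implicit Arguments.
Unset Strict Implicit.
Unset Printing Implicit Defensive.
Import Order.TTheory GRing.Theory Num.Theory.
Local Open Scope classical_set_scope.
Local Open Scope ring_scope.

(* Conventions. The values 0 and 1 are [false] and [true].  A word
   (a_j, ..., a_1) is given by a sequence [a : nat -> bool] of which only the
   entries a 1, ..., a j are read; likewise for families of random variables,
   index 0 is never used. *)

Definition prob d (T : measurableType d) (R : realType) (P : probability T R)
  (A : set T) : R := fine (P A).

(* Total: the value is 0 when P B = 0. *)
Definition cprob d (T : measurableType d) (R : realType) (P : probability T R)
  (A B : set T) : R := prob P (A `&` B) / prob P B.

Section Processes.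
Context d (T : measurableType d) (R : realType) (P : probability T R).
Implicit Types X Y : nat -> {RV P >-> bool}.

Definition event X (i : nat) (b : bool) : set T := [set w | X i w = b].

Definition traj X (lo hi : nat) (a : nat -> bool) : set T :=
  [set w | forall i, (lo <= i <= hi)%N -> X i w = a i].

Definition independent_seq Y : Prop :=
  forall (J : {fset nat}) (B : nat -> set bool),
    (forall i, i \in J -> (1 <= i)%N) ->
    P (\bigcap_(i in [set` J]) Y i @^-1` B i)
      = (\prod_(i <- J) P (Y i @^-1` B i))%E.

Record feller_coupling (theta : nat -> R) Y : Prop := FellerCoupling {
  feller_indep : independent_seq Y;
  feller_law : forall i, (1 <= i)%N ->
    prob P (event Y i false) = (i%:R - 1) / (i%:R - 1 + theta i) }.

(* Elementary conditional probabilities are prescribed only when the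
   conditioning event has nonzero probability. The chain runs through the
   indices n + 1, n, ..., 1, so the past of time r is r + 1, ..., n + 1. *)
Record derangement_process (n : nat) (p q : nat -> R) X : Prop :=
  DerangementProcess {
  derangement_start : prob P (event X n.+1 true) = 1;
  derangement_markov : forall (r : nat) (a : nat -> bool),
    (1 <= r <= n)%N -> prob P (traj X r.+1 n.+1 a) != 0 ->
    cprob P (event X r (a r)) (traj X r.+1 n.+1 a)
      = cprob P (event X r (a r)) (event X r.+1 (a r.+1));
  derangement_n : prob P (event X n false) = 1;
  derangement_1 : prob P (event X 1 true) = 1;
  derangement_0 : forall r, (2 <= r <= n.-1)%N ->
    prob P (event X r.+1 false) != 0 ->
    cprob P (event X r false) (event X r.+1 false) = p r /\
    cprob P (event X r true) (event X r.+1 false) = q r;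
  derangement_10 : forall r, (2 <= r <= n.-1)%N ->
    prob P (event X r.+1 true) != 0 ->
    cprob P (event X r false) (event X r.+1 true) = 1 }.

Definition Delta (j : nat) : set (nat -> bool) :=
  [set a | a 1%N = true /\
           (a j + \sum_(1 <= i < j) a i * a i.+1)%N = 0%N].

Definition in_Delta Y (j : nat) : set T := [set w | Delta j (fun i => Y i w)].

(* gamma_j(theta), when Y is the Feller coupling with parameter theta. *)
Definition gamma Y (j : nat) : R := prob P (in_Delta Y j).

End Processes.

(* [sorted] compares consecutive entries only: i_j + 1 < i_(j+1). *)
Definition G (R : realType) (theta : nat -> R) (i : nat) : R :=
  if i is 0 then 0
  else if (i <= 2)%N then 1
  else 1 + \sum_(1 <= k < (i.-1 %/ 2).+1)
             \sum_(t : k.-tuple 'I_i.+1 |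
                     all (fun x : 'I_i.+1 => (2 < x)%N) t &&
                     sorted (fun x y : 'I_i.+1 => (x.+1 < y)%N) t)
               \prod_(x <- t) (theta x / (x%:R - 1)).

(* Main.v *)
(* Both laws are explicit on [Delta n]. Put alpha_i = theta_i / (i - 1). The
   conditioned Feller coupling gives a word weight
   prod_(i : a_i = 1) alpha_i / G_(n-1): splitting a word of Delta_(j+2) on the
   entry a_(j+1) gives
   gamma_(j+2) = P(Y_(j+2) = 0) (gamma_(j+1) + P(Y_(j+1) = 1) gamma_j), which
   matches G_(i+2) = G_(i+1) + alpha_(i+2) G_i up to the factor
   prod_(i <= j) P(Y_i = 0); in particular the second equality of (ii) always
   holds. The chain gives a word the product of its transition weights.
   Comparing the words with at most one 1 besides a_1 yields
   alpha_i = q_i / (p_i p_(i-1)), i.e. (iii); with p_2 = 1 = G_1 / G_2 this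
   recursion is solved exactly by p_i = G_(i-1) / G_i, for which the product of
   transition weights telescopes to the conditioned Feller law. *)
Require Import Defs.
From HB Require Import structures.
From mathcomp Require Import all_boot all_order all_algebra.
From mathcomp Require Import all_classical all_reals all_analysis.
From mathcomp Require Import finmap zify ring.
Set Implicit Arguments.
Unset Strict Implicit.
Unset Printing Implicit Defensive.
Import Order.TTheory GRing.Theory Num.Theory.
Local Open Scope classical_set_scope.
Local Open Scope ring_scope.

(** * Sparse-subset sums: the recursion and positivity of [G] *)

Section GapSums.
Context (R : realType).
Implicit Types (alpha theta : nat -> R) (k m : nat).

(* The sum of [alpha i_1 * ... * alpha i_k] over 2 < i_1, i_j + 1 < i_(j+1) and
   i_k <= m, organised by the value of the largest index i_k. *)
Fixpoint gap_sum alpha k m : R :=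
  if k is k'.+1 then \sum_(3 <= x < m.+1) alpha x * gap_sum alpha k' x.-2
  else 1.

(** Reindexing by [rcons], an injection between finite types of equal cardinality; this isolates the
    last, hence largest, index. *)
Lemma sum_rcons_tuple (T : finType) k (Q : pred (seq T)) (F : seq T -> R) :
  \sum_(t : k.+1.-tuple T | Q t) F t =
  \sum_(x : T) \sum_(t : k.-tuple T | Q (rcons t x)) F (rcons t x).
Proof.
rewrite pair_big_dep (reindex (fun u : T * k.-tuple T => rcons_tuple u.2 u.1)) //=.
apply: onW_bij; apply: inj_card_bij; last by rewrite card_prod !card_tuple expnS.
move=> [x t] [y s] /(congr1 val) /= /rcons_inj [/val_inj-> ->] //.
Qed.

(** Peel off the largest entry [x]: the gap condition bounds the others by [x - 2]. The cutoff [m]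
    is separate from [N] so that it can decrease while the ordinal type stays fixed. *)
Lemma gap_sumE alpha N k m : (m < N)%N ->
  \sum_(t : k.-tuple 'I_N | all (fun x : 'I_N => (2 < x <= m)%N) t &&
          sorted (fun x y : 'I_N => (x.+1 < y)%N) t) \prod_(x <- t) alpha x
  = gap_sum alpha k m.
Proof.
have gap_trans : transitive (fun x y : 'I_N => (x.+1 < y)%N) by move=> ? ? ?; lia.
elim: k m => [|k IH] m mN.
  rewrite (bigD1 [tuple]) //= big_nil big1 ?addr0 // => t /andP[_].
  by case/eqP; apply: tuple0.
rewrite (@sum_rcons_tuple 'I_N k (fun t => all _ t && sorted _ t)
          (fun t => \prod_(x <- t) alpha x)) /=.
have -> : \sum_(3 <= x < m.+1) alpha x * gap_sum alpha k x.-2 =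
    \sum_(x < N | (2 < x <= m)%N) alpha x * gap_sum alpha k x.-2.
  rewrite (big_ord_widen_cond N (fun x => 2 < x <= m)%N
            (fun x => alpha x * gap_sum alpha k x.-2)) //.
  rewrite (big_nat_widenl _ 0) // (big_nat_widen _ _ N) // big_mkord.
  by apply: eq_bigl => x /=; lia.
rewrite [RHS]big_mkcond /=; apply: eq_bigr => x _.
case: ifPn => [/andP[x2 xm]|xNm].
  rewrite -IH; last by move: (ltn_ord x); lia.
  rewrite mulr_sumr; apply: eq_big => [t|t _]; last first.
    by rewrite big_rcons //= mulrC.
  rewrite !sorted_pairwise // pairwise_rcons all_rcons x2 xm andbA /=; congr andb.
  rewrite -all_predI; apply: eq_all => y /=; lia.
rewrite big1 // => t; rewrite all_rcons; move: xNm => /negbTE -> //.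
Qed.

(** The tightest choice of [k] indices is 3, 5, ..., 2k + 1, so none fits below 2k + 1. *)
Lemma gap_sum0 alpha k m : (m <= k.*2)%N -> (0 < k)%N -> gap_sum alpha k m = 0.
Proof.
case: k => // k; elim: k m => [|k IH] m mk _.
  by rewrite /= big_geq.
rewrite [gap_sum _ _ _]/= big1_seq // => x; rewrite mem_index_iota => /andP[_ xm].
by rewrite -/(gap_sum alpha k.+1 _) IH ?mulr0 //; lia.
Qed.

(** For [i >= 2], the odds of [Y_i = 1] against [Y_i = 0]. *)
Definition ratio theta i : R := theta i / (i%:R - 1).

(** The added terms vanish by [gap_sum0]. The free bound [K] allows values of [G] at different
    indices to be summed over matching ranges. *)
Lemma G_gap_sum theta m K : (m <= K.*2)%N ->
  G theta m.+1 = \sum_(0 <= k < K.+1) gap_sum (ratio theta) k m.+1.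
Proof.
move=> mK; rewrite big_nat_recl //=.
case: ifP => m2.
  rewrite big1_seq ?addr0 // => k _.
  by rewrite -/(gap_sum _ k.+1 _) gap_sum0 //; lia.
congr (1 + _).
have -> : \sum_(0 <= i < K) gap_sum (ratio theta) i.+1 m.+1
   = \sum_(1 <= k < K.+1) gap_sum (ratio theta) k m.+1 by rewrite big_add1.
rewrite [RHS](big_cat_nat (n := (m %/ 2).+1)) //=; last by lia.
rewrite [X in _ = _ + X]big1_seq ?addr0; last first.
  move=> k; rewrite mem_index_iota => /andP[_ km].
  by rewrite gap_sum0 //; lia.
apply: eq_bigr => k _; rewrite -(gap_sumE _ _ (ltnSn m.+1)).
apply: eq_bigl => t; congr (_ && _); apply: eq_all => x.
by have := ltn_ord x; lia.
Qed.

(** Either the index [i + 2] is not selected, or it is the largest one and the others are at most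
    [i]. *)
Lemma G_rec theta i :
  G theta i.+2 = G theta i.+1 + ratio theta i.+2 * G theta i.
Proof.
(* [G theta 0 = 0] is a convention, not a sum of gap sums, so this case is separate. *)
case: i => [|i]; first by rewrite /= mulr0 addr0.
(* The last range is one shorter because the factor [ratio theta i.+3] already uses one index. *)
rewrite (@G_gap_sum _ i.+2 i.+2) ?(@G_gap_sum _ i.+1 i.+2)
  ?(@G_gap_sum _ i i.+1); [|lia..].
rewrite mulr_sumr big_nat_recl // [in X in _ = X + _]big_nat_recl // -addrA.
congr (1 + _); rewrite -big_split /=; apply: eq_bigr => k _.
by rewrite big_nat_recr.
Qed.

Lemma G_gt0 theta i : (forall i, (3 <= i)%N -> 0 < theta i) -> 0 < G theta i.+1.
Proof.
move=> theta0.
suff [] : 0 < G theta i.+1 /\ 0 < G theta i.+2 by [].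
elim: i => [|i [IH0 IH1]]; first by rewrite /= ltr01.
split => //; rewrite G_rec addr_gt0 // mulr_gt0 // divr_gt0 ?theta0 //.
Qed.

End GapSums.

Local Arguments G : simpl never.

(** * Words without adjacent ones *)

Lemma DeltaP j (a : nat -> bool) :
  Delta j a <-> [/\ a 1%N = true, a j = false &
    forall i, (1 <= i < j)%N -> ~~ (a i && a i.+1)].
Proof.
split=> [[a1 /eqP]|[a1 aj nadj]].
  rewrite addn_eq0 => /andP[aj0 S0]; split=> //; first by case: (a j) aj0.
  move=> i ij; apply/negP => /andP[ai aSi]; move: S0.
  rewrite (bigD1_seq i) ?iota_uniq ?mem_index_iota //=.
  by rewrite ai aSi.
split=> //; rewrite aj big1_seq // => i /=.
by rewrite mem_index_iota => /nadj; case: (a i) (a i.+1) => [] [].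
Qed.

(** If [a j.+1] is 1, its neighbour [a j] must be 0, and the shorter word lies in [Delta j]. *)
Lemma Delta_rec j (a : nat -> bool) : (1 <= j)%N ->
  Delta j.+2 a <->
  a j.+2 = false /\ (Delta j.+1 a \/ (a j.+1 = true /\ Delta j a)).
Proof.
move=> j1; rewrite !DeltaP; split.
  move=> [a1 aj nadj]; split=> //.
  have nadj1 i : (1 <= i < j.+1)%N -> ~~ (a i && a i.+1).
    by move=> ij; apply: nadj; lia.
  case E: (a j.+1); [right|by left].
  split=> //; split=> // [|i ij]; last by apply: nadj; lia.
  by have := nadj j ltac:(lia); rewrite E andbT => /negbTE.
move=> [aj2 aj]; have a1 : a 1%N by case: aj => [[]|[_ []]].
split=> // i ij; have [->|iNj1] := eqVneq i j.+1; first by rewrite aj2 andbF.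
case: aj => [[_ aj1 nadj]|[_ [_ aj nadj]]]; first by apply: nadj; lia.
have [->|iNj] := eqVneq i j; first by rewrite aj.
by apply: nadj; lia.
Qed.

(** * Measurability and real-valued probabilities of trajectories *)

Section Trajectories.
Context d (T : measurableType d) (R : realType) (P : probability T R).
Implicit Types X Y : nat -> {RV P >-> bool}.

Lemma event_measurable X i b : measurable (event X i b).
Proof.
rewrite (_ : event X i b = X i @^-1` [set b]); last by apply/seteqP; split.
by rewrite -[_ @^-1` _]setTI; apply: measurable_funP.
Qed.

Lemma traj_nil X lo hi a : (hi < lo)%N -> traj X lo hi a = setT.
Proof. by move=> lohi; apply/seteqP; split=> // w _ i; lia. Qed.

Lemma trajS X lo hi a : (lo <= hi)%N ->
  traj X lo hi a = event X lo (a lo) `&` traj X lo.+1 hi a.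
Proof.
move=> lohi; apply/seteqP; split=> w /=.
  by move=> wa; split=> [|i ilh]; apply: wa; lia.
move=> [wlo wa] i ilh; have [->//|iNlo] := eqVneq i lo.
by apply: wa; lia.
Qed.

Lemma traj_measurable X lo hi a : measurable (traj X lo hi a).
Proof.
have [k] : exists k, (hi.+1 - lo)%N = k by eexists.
elim: k lo => [|k IH] lo lok; first by rewrite traj_nil //; lia.
rewrite trajS; last by lia.
by apply: measurableI; [exact: event_measurable|apply: IH; lia].
Qed.

Lemma prob_ge0 (A : set T) : 0 <= prob P A.
Proof. exact: fine_ge0. Qed.

Lemma prob_EFin (A : set T) : measurable A -> P A = (prob P A)%:E.
Proof. by move=> mA; rewrite /prob fineK // fin_num_measure. Qed.

Lemma prob_le (A B : set T) : measurable A -> measurable B -> A `<=` B ->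
  prob P A <= prob P B.
Proof.
move=> mA mB AB; rewrite -lee_fin -!prob_EFin //.
by apply: le_measure => //; exact: mem_set.
Qed.

Lemma prob_setU (A B : set T) : measurable A -> measurable B ->
  A `&` B = set0 -> prob P (A `|` B) = prob P A + prob P B.
Proof.
move=> mA mB AB; apply: EFin_inj.
by rewrite EFinD -!prob_EFin ?measureU //; exact: measurableU.
Qed.

Lemma prob_setC (A : set T) : measurable A -> prob P (~` A) = 1 - prob P A.
Proof.
move=> mA; apply: EFin_inj.
by rewrite EFinB -!prob_EFin ?probability_setC //; exact: measurableC.
Qed.

Lemma prob_setI1 (A B : set T) : measurable A -> measurable B ->
  prob P A = 1 -> prob P (A `&` B) = prob P B.
Proof.
move=> mA mB PA1; have mC := measurableC mA.
have -> : prob P B = prob P (A `&` B) + prob P (~` A `&` B).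
  rewrite -prob_setU -?setIUl ?setUv ?setTI //; try exact: measurableI.
  by rewrite setIACA setICr set0I.
suff -> : prob P (~` A `&` B) = 0 by rewrite addr0.
apply/le_anti; rewrite prob_ge0 andbT.
rewrite (le_trans (prob_le _ mC _)) //; first exact: measurableI.
by rewrite prob_setC // PA1 subrr.
Qed.

End Trajectories.

(** * The conditioned law of the Feller coupling *)

Section FellerCoupling.
Context d (T : measurableType d) (R : realType) (P : probability T R).
Context (theta : nat -> R) (Y : nat -> {RV P >-> bool}).
Hypothesis theta_gt0 : forall i, (1 <= i)%N -> 0 < theta i.
Hypothesis Yfc : feller_coupling theta Y.

Definition feller_weight i (b : bool) : R :=
  (if b then theta i else i%:R - 1) / (i%:R - 1 + theta i).

Lemma feller_den_gt0 i : (1 <= i)%N -> 0 < i%:R - 1 + theta i.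
Proof. by move=> i1; rewrite ltr_wpDl ?theta_gt0 // subr_ge0 ler1n. Qed.

Lemma feller_weight1 : feller_weight 1 true = 1.
Proof. by rewrite /feller_weight subrr add0r divff // gt_eqF // theta_gt0. Qed.

Lemma prob_event i b : (1 <= i)%N -> prob P (event Y i b) = feller_weight i b.
Proof.
move=> i1; case: b; last exact: feller_law Yfc i i1.
have -> : event Y i true = ~` event Y i false.
  by apply/seteqP; split=> w /=; rewrite /event /=; case: (Y i w).
rewrite prob_setC ?(feller_law Yfc) //; last exact: event_measurable.
rewrite /feller_weight; field; rewrite gt_eqF // feller_den_gt0 //.
Qed.

Lemma prob_traj lo hi b : (1 <= lo)%N ->
  prob P (traj Y lo hi b) = \prod_(lo <= i < hi.+1) feller_weight i (b i).
Proof.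
move=> lo1; apply: EFin_inj.
rewrite -prob_EFin; last exact: traj_measurable.
(* Independence is stated over finite sets, so the interval becomes [J] and each prescribed value a
   singleton. *)
pose J := [fset i in index_iota lo hi.+1]%fset.
have JE i : (i \in J) = (lo <= i <= hi)%N by rewrite !inE /= mem_index_iota ltnS.
rewrite (_ : traj _ _ _ _ = \bigcap_(i in [set` J]) Y i @^-1` [set b i]); last first.
  by apply/seteqP; split=> w wb i; have := wb i; rewrite /= JE.
rewrite (feller_indep Yfc); last by move=> i; rewrite JE; lia.
rewrite -prodEFin (perm_big (index_iota lo hi.+1)) /=; last first.
  apply: uniq_perm; rewrite ?iota_uniq ?fset_uniq // => i.
  by rewrite JE mem_index_iota ltnS.
apply: eq_big_seq => i; rewrite mem_index_iota => /andP[loi _].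
rewrite (_ : _ @^-1` _ = event Y i (b i)); last by apply/seteqP; split.
rewrite prob_EFin ?prob_event //; last exact: event_measurable.
by apply: leq_trans loi.
Qed.

Lemma in_Delta1 : in_Delta Y 1 = set0.
Proof. by apply/seteqP; split=> // w /= /DeltaP[->]. Qed.

Lemma in_Delta2 : in_Delta Y 2 = traj Y 1 2 (pred1 1%N).
Proof.
apply/seteqP; split=> w /=.
  by move=> /DeltaP[Y1 Y2 _] [|[|[|i]]].
move=> wY; apply/DeltaP; rewrite (wY 1%N) // (wY 2%N) //.
by split=> // [] [|[|]] //=; rewrite (wY 2%N) // andbF.
Qed.

Lemma in_Delta_rec j : (1 <= j)%N ->
  in_Delta Y j.+2 = event Y j.+2 false `&`
    (in_Delta Y j.+1 `|` (event Y j.+1 true `&` in_Delta Y j)).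
Proof.
by move=> j1; apply/seteqP; split=> w /=; rewrite /in_Delta /= Delta_rec.
Qed.

Lemma in_Delta_measurable j : (1 <= j)%N -> measurable (in_Delta Y j).
Proof.
move=> j1.
suff [] : measurable (in_Delta Y j) /\ measurable (in_Delta Y j.+1) by [].
elim: j j1 => [//|[|j] IH _].
  by rewrite in_Delta1 in_Delta2; split=> //; exact: traj_measurable.
have [//|m0 m1] := IH; split=> //; rewrite in_Delta_rec //.
apply: measurableI; first exact: event_measurable.
by apply: measurableU => //; apply: measurableI => //; exact: event_measurable.
Qed.

(** The factor relating [gamma Y j] to [G theta j.-1]. It starts at 2 because
    [feller_weight 1 false] is 0. *)
Definition zeros_weight j : R := \prod_(2 <= i < j.+1) feller_weight i false.

Lemma zeros_weightS j : (1 <= j)%N ->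
  zeros_weight j.+1 = zeros_weight j * feller_weight j.+1 false.
Proof. by move=> j1; rewrite /zeros_weight big_nat_recr. Qed.

Lemma zeros_weight_gt0 j : 0 < zeros_weight j.
Proof.
rewrite /zeros_weight big_seq; apply: prodr_gt0 => i.
rewrite mem_index_iota => /andP[i2 _].
by rewrite divr_gt0 ?feller_den_gt0 ?subr_gt0 ?ltr1n //; lia.
Qed.

Lemma feller_weight_ratio i b : (2 <= i)%N ->
  feller_weight i b = feller_weight i false * (if b then ratio theta i else 1).
Proof.
move=> i2; rewrite /feller_weight /ratio; case: b; last by rewrite mulr1.
have := @feller_den_gt0 i ltac:(lia).
have : 0 < i%:R - 1 :> R by rewrite subr_gt0 ltr1n.
by move=> ? ?; field; rewrite !gt_eqF.
Qed.

(* The extra trajectory above [j] makes the recursion on [j] close up: it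
   stands in for the independence of [in_Delta Y j] from the later variables. *)
Lemma prob_in_Delta_traj j m b : (1 <= j)%N -> (j <= m)%N ->
  prob P (in_Delta Y j `&` traj Y j.+1 m b) =
  zeros_weight j * G theta j.-1 * \prod_(j.+1 <= i < m.+1) feller_weight i (b i).
Proof.
move=> j1.
(* The recursion has order two, so [j] and [j + 1] are carried together. *)
suff [] : (forall m b, (j <= m)%N ->
    prob P (in_Delta Y j `&` traj Y j.+1 m b) =
    zeros_weight j * G theta j.-1 *
      \prod_(j.+1 <= i < m.+1) feller_weight i (b i)) /\
  (forall m b, (j.+1 <= m)%N ->
    prob P (in_Delta Y j.+1 `&` traj Y j.+2 m b) =
    zeros_weight j.+1 * G theta j *
      \prod_(j.+2 <= i < m.+1) feller_weight i (b i)) by move=> + _; apply.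
elim: j {m b} j1 => [//|[|j] IH _].
  split=> m b m1.
    (* [Delta 1] is empty, in agreement with [G theta 0 = 0]. *)
    by rewrite in_Delta1 set0I /G mulr0 mul0r /prob measure0.
  (* [Delta 2] holds the single word (0, 1); prefixed to [b] it turns the event into one
     trajectory. *)
  pose b' i := if (i <= 2)%N then i == 1%N else b i.
  have -> : in_Delta Y 2 `&` traj Y 3 m b = traj Y 1 m b'.
    rewrite in_Delta2; apply/seteqP; split=> w /=.
      move=> [w2 wm] i im; rewrite /b'; case: ifP => i2; first by apply: w2; lia.
      by apply: wm; lia.
    move=> wb; split=> i im; rewrite (wb i) /b' //; [|lia| |lia].
    - by rewrite ifT //; lia.
    - by rewrite ifF //; lia.
  rewrite prob_traj; last by [].
  rewrite (big_ltn (m := 1)) 1?(big_ltn (m := 2)); [|lia..].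
  rewrite /zeros_weight big_nat1 /b' /G /= feller_weight1 mul1r mulr1.
  congr (_ * _).
  by apply: eq_big_nat => i i3; rewrite ifF //; lia.
have [//|H0 H1] := IH; split=> // m b jm.
(* The two branches of [in_Delta_rec]: [b1] records the 0 at [j + 3], and [b2] also the 1 at
   [j + 2]. *)
pose b1 i := if i == j.+3 then false else b i.
pose b2 i := if i == j.+2 then true else b1 i.
have -> : in_Delta Y j.+3 `&` traj Y j.+4 m b =
  (in_Delta Y j.+2 `&` traj Y j.+3 m b1) `|`
  (in_Delta Y j.+1 `&` traj Y j.+2 m b2).
  have tr2 : traj Y j.+2 m b2 = event Y j.+2 true `&` traj Y j.+3 m b1.
    rewrite trajS; last by lia.
    rewrite {1}/b2 eqxx; congr (_ `&` _).
    by apply/seteqP; split=> w wb i im; have := wb i im; rewrite /b2 ifF //; lia.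
  have tr1 : traj Y j.+3 m b1 = event Y j.+3 false `&` traj Y j.+4 m b.
    rewrite trajS; last by lia.
    rewrite {1}/b1 eqxx; congr (_ `&` _).
    by apply/seteqP; split=> w wb i im; have := wb i im; rewrite /b1 ifF //; lia.
  rewrite in_Delta_rec // tr2 tr1.
  by apply/seteqP; split=> w /=; tauto.
have mI k l c : (1 <= k)%N -> measurable (in_Delta Y k `&` traj Y l m c).
  move=> k1; apply: measurableI; first exact: in_Delta_measurable.
  exact: traj_measurable.
(* The branches are disjoint: [Y j.+2] is 0 in the first and 1 in the second. *)
rewrite prob_setU; [|exact: mI|exact: mI|]; last first.
  apply/seteqP; split=> // w [[/DeltaP[_ Yj _] _] [_ /(_ j.+2)]].
  by rewrite Yj /b2 eqxx => /(_ ltac:(lia)).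
rewrite H1 ?H0; [|lia..].
rewrite !succnK.
rewrite G_rec (zeros_weightS (j := j.+2)) // (zeros_weightS (j := j.+1)) //.
rewrite (big_ltn (m := j.+2)) 1?(big_ltn (m := j.+3)); [|lia..].
rewrite (big_ltn (m := j.+3)); last by lia.
have -> : \prod_(j.+4 <= i < m.+1) feller_weight i (b2 i) =
          \prod_(j.+4 <= i < m.+1) feller_weight i (b i).
  by apply: eq_big_nat => i i3; rewrite /b2 /b1 !ifF //; lia.
have -> : \prod_(j.+4 <= i < m.+1) feller_weight i (b1 i) =
          \prod_(j.+4 <= i < m.+1) feller_weight i (b i).
  by apply: eq_big_nat => i i3; rewrite /b1 !ifF //; lia.
have -> : b2 j.+2 = true by rewrite /b2 eqxx.
have -> : b1 j.+3 = false by rewrite /b1 eqxx.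
have -> : b2 j.+3 = false by rewrite /b2 /b1 eqxx ifF //; lia.
(* Writing the weight of the 1 as odds times the weight of a 0 gives both branches the same product
   of zero weights. *)
rewrite (@feller_weight_ratio j.+2 true) /=; last by [].
ring.
Qed.

Lemma gammaE j : (1 <= j)%N -> gamma Y j = zeros_weight j * G theta j.-1.
Proof.
move=> j1; have := @prob_in_Delta_traj j j (fun=> false) j1 (leqnn j).
by rewrite traj_nil // setIT big_geq // mulr1.
Qed.

(** By independence the trajectory has probability [zeros_weight n] times the odds of its ones, and
    [zeros_weight n] cancels against [gamma Y n]. The ends contribute nothing, since [a 1] is 1
    almost surely and [a n] is 0. *)
Lemma cprob_traj n a : (2 <= n)%N -> Delta n a ->
  cprob P (traj Y 1 n a) (in_Delta Y n) =
  (\prod_(2 <= i < n) if a i then ratio theta i else 1) / G theta n.-1.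
Proof.
move=> n2 an; have [a1 an0 _] := (DeltaP n a).1 an.
have tD : traj Y 1 n a `<=` in_Delta Y n.
  move=> w wa; have [_ _ nadj] := (DeltaP n a).1 an.
  apply/DeltaP; rewrite !wa //; [|lia..]; split=> // i ij.
  by rewrite !wa ?nadj //; lia.
rewrite /cprob setIidl // -/(gamma Y n) gammaE; last by lia.
rewrite prob_traj; last by [].
rewrite big_ltn; last by lia.
rewrite a1 feller_weight1 mul1r.
have -> : \prod_(2 <= i < n.+1) feller_weight i (a i) = zeros_weight n *
   \prod_(2 <= i < n) if a i then ratio theta i else 1.
  transitivity (zeros_weight n *
   \prod_(2 <= i < n.+1) if a i then ratio theta i else 1).
    rewrite -big_split /=; apply: eq_big_nat => i /andP[i2 _].
    exact: feller_weight_ratio.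
  by rewrite [X in _ * X]big_nat_recr //= an0 mulr1.
by rewrite -mulf_div divff ?mul1r // gt_eqF // zeros_weight_gt0.
Qed.

End FellerCoupling.

(** * The law of the derangement process on [Delta n] *)

Section DerangementProcess.
Context (R : realType) (p q : nat -> R).
Hypothesis p2 : p 2%N = 1.
Hypothesis p_itv : forall i, (3 <= i)%N -> 0 < p i < 1.
Hypothesis qE : forall i, (1 <= i)%N -> q i = 1 - p i.

(** The transition probability from [b r.+1] at time [r + 1] down to [b r] at time [r]. *)
Definition step_weight r (b : nat -> bool) : R :=
  if b r.+1 then (~~ b r)%:R else if b r then q r else p r.

Lemma p_gt0 r : (2 <= r)%N -> 0 < p r.
Proof.
case: r => [|[|[|r]]] // _; first by rewrite p2 ltr01.
by have /andP[] := p_itv (i := r.+3) isT.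
Qed.

(** The weight can vanish only on adjacent ones or as [q 2 = 0]; the latter would put a 1 at index
    2, next to [b 1]. Positivity keeps all conditioning events non-null. *)
Lemma step_weight_gt0 n b r : Delta n b -> (2 <= r < n)%N -> 0 < step_weight r b.
Proof.
move=> /DeltaP[b1 bn nadj] rn; rewrite /step_weight.
have := nadj r ltac:(lia); case E1: (b r.+1); case E: (b r) => //= _.
  have r2 : r != 2%N.
    by apply/eqP => r2; have := nadj 1%N ltac:(lia); rewrite b1 -r2 E.
  rewrite qE ?subr_gt0; last by lia.
  by have /andP[] := p_itv (i := r) ltac:(lia).
by apply: p_gt0; lia.
Qed.

Context d (T : measurableType d) (P : probability T R).
Context (n : nat) (X : nat -> {RV P >-> bool}).
Hypothesis n2 : (2 <= n)%N.
Hypothesis Xdp : derangement_process n p q X.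

Lemma prob_step r a : Delta n a -> (2 <= r < n)%N ->
  prob P (traj X r.+1 n.+1 a) != 0 ->
  prob P (traj X r n.+1 a) = step_weight r a * prob P (traj X r.+1 n.+1 a).
Proof.
move=> /DeltaP[_ _ nadj] rn Pn0.
rewrite trajS; last by lia.
have := derangement_markov Xdp (a := a) (r := r) ltac:(lia) Pn0.
rewrite {1}/cprob => /(canRL (mulfVK Pn0)) ->; congr (_ * _).
(* The one-step conditioning event contains the whole past trajectory, hence is non-null as well. *)
have En0 : prob P (event X r.+1 (a r.+1)) != 0.
  rewrite gt_eqF //; apply: (@lt_le_trans _ _ (prob P (traj X r.+1 n.+1 a))).
    by rewrite lt_neqAle eq_sym Pn0 prob_ge0.
  apply: prob_le; [exact: traj_measurable|exact: event_measurable|].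
  by move=> w; apply; lia.
have rn1 : (2 <= r <= n.-1)%N by lia.
have := nadj r ltac:(lia); rewrite /step_weight.
case E1: (a r.+1) En0; case E: (a r) => //= En0 _.
- exact: (derangement_10 Xdp rn1 En0).
- by case: (derangement_0 Xdp rn1 En0).
- by case: (derangement_0 Xdp rn1 En0).
Qed.

Lemma prob_traj_succ r a : Delta n a -> a n.+1 -> (2 <= r <= n)%N ->
  prob P (traj X r n.+1 a) = \prod_(r <= i < n) step_weight i a.
Proof.
move=> an aSn rn; have [k] : exists k, (n - r)%N = k by eexists.
elim: k r rn => [|k IH] r rn rk.
  have -> : r = n by lia.
  rewrite big_geq // trajS // trajS // traj_nil // setIT aSn.
  have [_ -> _] := (DeltaP n a).1 an.
  rewrite prob_setI1 ?(derangement_start Xdp) ?(derangement_n Xdp) //;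
    exact: event_measurable.
have Pr1 := IH r.+1 ltac:(lia) ltac:(lia).
rewrite prob_step ?Pr1 //; [|by lia|].
  by rewrite [RHS]big_ltn //; lia.
rewrite gt_eqF // big_seq; apply: prodr_gt0 => i; rewrite mem_index_iota => ir.
by apply: (step_weight_gt0 an); lia.
Qed.

Lemma prob_derangement_traj a : Delta n a ->
  prob P (traj X 1 n a) = \prod_(2 <= i < n) step_weight i a.
Proof.
(* [b] adds the starting value 1 at [n + 1], which [Delta n] does not read. *)
move=> an; pose b i := if i == n.+1 then true else a i.
have ba i : (i <= n)%N -> b i = a i by move=> ilen; rewrite /b ifF //; lia.
have bn : Delta n b.
  have [a1 an0 nadj] := (DeltaP n a).1 an.
  by apply/DeltaP; rewrite !ba //; [split=> // i ij; rewrite !ba ?nadj|]; lia.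
have -> : \prod_(2 <= i < n) step_weight i a = \prod_(2 <= i < n) step_weight i b.
  by apply: eq_big_nat => i ij; rewrite /step_weight !ba //; lia.
rewrite -prob_traj_succ ?n2 ?leqnn // ?/b ?eqxx // -/b.
have [a1 _ _] := (DeltaP n a).1 an.
have b' : b n.+1 = true by rewrite /b eqxx.
have -> : traj X 2 n.+1 b = event X n.+1 true `&` traj X 2 n a.
  apply/seteqP; split=> w /=.
    move=> wb; split; first by rewrite /event /= wb // leqnn; lia.
    by move=> i ij; rewrite wb ?ba //; lia.
  move=> [wn wa] i ij; have [->|iNn] := eqVneq i n.+1; first by rewrite b'.
  by rewrite ba ?wa //; lia.
rewrite trajS; last by lia.
(* The almost sure values at times [n + 1] and 1 are dropped. *)
rewrite a1 !prob_setI1 //; try exact: event_measurable; try exact: traj_measurable.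
  exact: derangement_start Xdp.
exact: derangement_1 Xdp.
Qed.

End DerangementProcess.

(** * Algebraic relations between [p], [theta] and [G] *)

Section ParameterRelations.
Context (R : realType) (p q theta : nat -> R).
Hypothesis p2 : p 2%N = 1.
Hypothesis p_itv : forall i, (3 <= i)%N -> 0 < p i < 1.
Hypothesis qE : forall i, (1 <= i)%N -> q i = 1 - p i.
Hypothesis theta_gt0 : forall i, (1 <= i)%N -> 0 < theta i.

Lemma G_pos i : 0 < G theta i.+1.
Proof. by apply: G_gt0 => j j3; apply: theta_gt0; lia. Qed.

(* Comparing the word with no ones beyond [a_1] with the one whose only other
   one is at [i] isolates [q_i / (p_i p_(i-1))]. *)
Lemma ratio_of_words n Z : Z != 0 ->
  (forall a, Delta n a -> \prod_(2 <= r < n) step_weight p q r a =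
     (\prod_(2 <= r < n) if a r then ratio theta r else 1) / Z) ->
  forall i, (3 <= i < n)%N -> ratio theta i = q i / (p i * p i.-1).
Proof.
move=> Z0 words [//|j] jn; rewrite /=.
have p_neq0 r : (2 <= r)%N -> p r != 0.
  by move=> r2; rewrite gt_eqF // (p_gt0 p2 p_itv).
pose a0 (i : nat) := i == 1%N.
pose a1 (i : nat) := (i == 1%N) || (i == j.+1).
have D0 : Delta n a0.
  by apply/DeltaP; rewrite /a0 /=; split=> // [|i ij]; lia.
have D1 : Delta n a1.
  by apply/DeltaP; rewrite /a1 /=; split=> // [|i ij]; lia.
have := words _ D1; have := words _ D0.
(* With [i = j + 1], the transition weights of the two words differ only at times [j] and
   [j + 1]. *)
have split_prod (F : nat -> R) : \prod_(2 <= r < n) F r =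
    (\prod_(2 <= r < j) F r) * (F j * (F j.+1 * \prod_(j.+2 <= r < n) F r)).
  rewrite (big_cat_nat (n := j)) /=; [|lia..].
  by rewrite (big_ltn (m := j)) 1?(big_ltn (m := j.+1)); [|lia..].
rewrite !(split_prod (fun r => step_weight p q r _)).
rewrite (split_prod (fun r => if a1 r then _ else _)).
rewrite [X in _ = X / Z -> _]big1_seq; last first.
  by move=> i /=; rewrite mem_index_iota /a0 /= => i2; rewrite ifF //; lia.
rewrite [X in _ -> _ = X * _ / Z -> _]big1_seq; last first.
  by move=> i /=; rewrite mem_index_iota /a1 /= => i2; rewrite ifF //; lia.
rewrite [X in _ -> _ = _ * (_ * (_ * X)) / Z -> _]big1_seq; last first.
  by move=> i /=; rewrite mem_index_iota /a1 /= => i2; rewrite ifF //; lia.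
have w0 r : (2 <= r)%N -> step_weight p q r a0 = p r.
  by move=> r2; rewrite /step_weight /a0 /= !ifF //; lia.
have w1 r : (2 <= r)%N -> r != j -> r != j.+1 -> step_weight p q r a1 = p r.
  by move=> r2 rj rj1; rewrite /step_weight /a1 !ifF //; lia.
(* After the 1 at [j + 1] the chain is forced to 0. *)
have -> : step_weight p q j a1 = 1.
  by rewrite /step_weight /a1 eqxx orbT (_ : (_ || _) = false) //; lia.
have -> : step_weight p q j.+1 a1 = q j.+1.
  by rewrite /step_weight /a1 eqxx orbT ifF //; lia.
rewrite !(w0 j) ?(w0 j.+1); [|lia..].
have lo a : a = a0 \/ a = a1 ->
   \prod_(2 <= r < j) step_weight p q r a = \prod_(2 <= r < j) p r.
  move=> aE; apply: eq_big_nat => r rj.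
  by case: aE => ->; [apply: w0|apply: w1]; lia.
have hi a : a = a0 \/ a = a1 ->
   \prod_(j.+2 <= r < n) step_weight p q r a = \prod_(j.+2 <= r < n) p r.
  move=> aE; apply: eq_big_nat => r rj.
  by case: aE => ->; [apply: w0|apply: w1]; lia.
have or0 : a0 = a0 \/ a0 = a1 by left.
have or1 : a1 = a0 \/ a1 = a1 by right.
rewrite (lo _ or0) (lo _ or1) (hi _ or0) (hi _ or1).
have -> : a1 j = false by rewrite /a1; lia.
have -> : a1 j.+1 = true by rewrite /a1 eqxx orbT.
set A := \prod_(2 <= r < j) p r; set B := \prod_(j.+2 <= r < n) p r.
have pj := p_neq0 j ltac:(lia); have pj1 := p_neq0 j.+1 ltac:(lia).
rewrite !mul1r mulr1 => E0 E1.
(* The word [a0] determines the common factor [A * B], which is then eliminated from the equation of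
   [a1]. *)
have AB : A * B = (p j * p j.+1 * Z)^-1.
  apply: (mulfI (mulf_neq0 pj pj1)).
  have -> : p j * p j.+1 * (A * B) = A * (p j * (p j.+1 * B)) by ring.
  by rewrite E0; field; rewrite pj pj1 Z0.
have -> : ratio theta j.+1 = ratio theta j.+1 / Z * Z by rewrite divfK.
rewrite -E1 mulrCA AB; field; by rewrite pj pj1 Z0.
Qed.

(** Induction from [p 2 = 1 = G_1 / G_2]: inserting the quotient for [p i.-1] into [G_rec] leaves
    [G_i = G_(i-1) / p_i]. *)
Lemma G_quot_of_ratio n :
  (forall i, (3 <= i < n)%N -> ratio theta i = q i / (p i * p i.-1)) ->
  forall i, (2 <= i < n)%N -> p i = G theta i.-1 / G theta i.
Proof.
move=> ratioE; elim=> [//|[//|[_|i IH]]] iltn.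
  by rewrite p2 /G /= divr1.
have := ratioE i.+3 iltn; rewrite /= IH; last by lia.
rewrite qE // => rE.
have p0 : p i.+3 != 0 by rewrite gt_eqF // (p_gt0 p2 p_itv).
have := G_rec theta i.+1; rewrite rE /=.
have := G_pos i; have := G_pos i.+1; have := G_pos i.+2.
move: (G theta i.+1) (G theta i.+2) (G theta i.+3) (p i.+3) p0.
move=> g1 g2 g3 x x0 g3p g2p g1p ->.
have -> : g2 + (1 - x) / (x * (g1 / g2)) * g1 = g2 / x.
  by field; rewrite x0 !gt_eqF.
by rewrite invf_div mulrCA divff ?mulr1 // gt_eqF.
Qed.

(** By [G_rec], [q_i = 1 - G_(i-1) / G_i = alpha_i G_(i-2) / G_i]; dividing by
    [p_i p_(i-1) = G_(i-2) / G_i] leaves [alpha_i]. *)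
Lemma ratio_of_G_quot n :
  (forall i, (3 <= i < n)%N -> p i = G theta i.-1 / G theta i) ->
  forall i, (3 <= i < n)%N -> ratio theta i = q i / (p i * p i.-1).
Proof.
move=> pE [|[|[|i]]] // iltn.
have p' : p i.+2 = G theta i.+1 / G theta i.+2.
  by case: i iltn => [_|i iltn]; [rewrite p2 /G /= divr1|apply: pE; lia].
rewrite qE // pE //= p' (G_rec _ i.+1).
have := G_pos i; have := G_pos i.+1; have := G_pos i.+2; rewrite (G_rec _ i.+1).
move: (G theta i.+1) (G theta i.+2) (ratio theta i.+3) => g1 g2 x g3p g2p g1p.
by field; rewrite !gt_eqF.
Qed.

Lemma words_of_G_quot n :
  (forall i, (2 <= i < n)%N -> p i = G theta i.-1 / G theta i) ->
  forall a, Delta n a -> (2 <= n)%N ->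
  \prod_(2 <= r < n) step_weight p q r a =
     (\prod_(2 <= r < n) if a r then ratio theta r else 1) / G theta n.-1.
Proof.
move=> pE a /DeltaP[a1 an nadj] n2.
(* Partial products telescope. If [a m] is 0, the word up to [m] lies in [Delta m], with normaliser
   [G theta m.-1]; if [a m] is 1, the word up to [m - 1] lies in [Delta m.-1], with normaliser
   [G theta m.-2]. *)
suff H m : (2 <= m <= n)%N -> \prod_(2 <= r < m) step_weight p q r a =
     (\prod_(2 <= r < m) if a r then ratio theta r else 1) /
     G theta (if a m then m.-2 else m.-1).
  by rewrite H ?an // n2 leqnn.
elim: m => [//|m IH] mn.
have [m1|m2] := leqP m 1.
  have -> : m = 1%N by lia.
  (* With [a 2 = 1] the denominator would be [G theta 0 = 0]; adjacency to [a 1], or [n = 2],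
     excludes this. *)
  rewrite !big_geq // (_ : a 2%N = false) /G /= ?divr1 //.
  have [-> //|n2'] := eqVneq 2%N n.
  by have := nadj 1%N ltac:(lia); rewrite a1 /= => /negbTE.
rewrite !big_nat_recr //= IH; last by lia.
rewrite /step_weight; have := nadj m ltac:(lia).
case: m {IH} mn m2 => [//|[//|m]] mn _.
have p0 := p_gt0 p2 p_itv (r := m.+2) erefl.
have pm := pE m.+2 ltac:(lia).
have g1 := G_pos m; have g2 := G_pos m.+1.
case: (a m.+3); case Em: (a m.+2) => //= _; rewrite ?mulr1 //.
  (* A 1 at index 2 would touch [a 1]; thus [m > 0] and the denominator [G theta m] is nonzero. *)
  have m0 : (0 < m)%N.
    rewrite lt0n; apply/eqP => m0; have := nadj 1%N ltac:(lia).
    by rewrite a1 -[2%N]/(0.+2)%N -m0 Em.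
  have g0 : 0 < G theta m by case: m m0 {mn p0 pm g1 g2 Em} => // m _; apply: G_pos.
  rewrite qE // pm /= G_rec in g2 *.
  move: (G theta m) (G theta m.+1) (ratio theta m.+2) g0 g1 g2 => ? ? ? ? ? ?.
  by field; rewrite !gt_eqF.
rewrite pm /=.
by field; rewrite !gt_eqF.
Qed.

End ParameterRelations.

(** * The cycle of implications from (i) to (ii) to (iii) and back *)

Theorem theorem3 (R : realType) (p q theta : nat -> R)
  (hp1 : p 1%N = 0) (hp2 : p 2%N = 1)
  (hp : forall i, (3 <= i)%N -> 0 < p i < 1)
  (hq : forall i, (1 <= i)%N -> q i = 1 - p i)
  (htheta : forall i, (1 <= i)%N -> 0 < theta i)
  (htheta1 : theta 1%N = 1)
  (n : nat) (hn : (4 <= n)%N)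
  (dX : measure_display) (TX : measurableType dX) (PX : probability TX R)
  (X : nat -> {RV PX >-> bool}) (hX : derangement_process n p q X)
  (dY : measure_display) (TY : measurableType dY) (PY : probability TY R)
  (Y : nat -> {RV PY >-> bool}) (hY : feller_coupling theta Y) :
  [<-> (forall a : nat -> bool, Delta n a ->
          prob PX (traj X 1 n a) = cprob PY (traj Y 1 n a) (in_Delta Y n));
       (forall i, (3 <= i <= n.-1)%N ->
          p i = ((i%:R - 1 + theta i) * gamma Y i) /
                ((i%:R - 1 + theta i) * gamma Y i + theta i * gamma Y i.-1) /\
          ((i%:R - 1 + theta i) * gamma Y i) /
                ((i%:R - 1 + theta i) * gamma Y i + theta i * gamma Y i.-1)
            = G theta i.-1 / G theta i);
       (forall i, (3 <= i <= n.-1)%N ->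
          theta i = ((i%:R - 1) * q i) / (p i * p i.-1))].
Proof.
have n2 : (2 <= n)%N by lia.
have itv i : (3 <= i < n)%N = (3 <= i <= n.-1)%N by lia.
have i1_gt0 i : (3 <= i)%N -> 0 < i%:R - 1 :> R.
  by move=> i3; rewrite subr_gt0 ltr1n; lia.
(* By [gammaE], the numerator is [zeros_weight i.-1 * (i - 1) * G_(i-1)] and, by [G_rec], the
   denominator is the same factor times [G_i]. *)
have gamma_quot i : (3 <= i)%N -> ((i%:R - 1 + theta i) * gamma Y i) /
    ((i%:R - 1 + theta i) * gamma Y i + theta i * gamma Y i.-1)
    = G theta i.-1 / G theta i.
  case: i => [|[|[|i]]] // i3.
  rewrite !(gammaE htheta hY) //= zeros_weightS // (G_rec _ i.+1).
  rewrite /feller_weight /ratio.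
  have := zeros_weight_gt0 htheta i.+2; have := i1_gt0 _ i3.
  have := htheta i.+3 isT; have := G_pos htheta i; have := G_pos htheta i.+1.
  move: (zeros_weight _ _) (G theta i.+2) (G theta i.+1) => z g2 g1.
  move: (theta i.+3) (i.+3%:R - 1) => t x g2p g1p tp xp zp.
  by field; rewrite !gt_eqF ?addr_gt0 ?mulr_gt0.
have thetaE i : (3 <= i)%N -> (theta i = ((i%:R - 1) * q i) / (p i * p i.-1)) <->
    ratio theta i = q i / (p i * p i.-1).
  move=> i3; rewrite /ratio; have x0 := lt0r_neq0 (i1_gt0 i i3).
  rewrite -mulrA; split=> [->|<-]; first by rewrite mulrC mulKf.
  by rewrite mulrC divfK.
(* For each single word, (i) is an identity between explicit weights. *)
have words a : Delta n a ->
    (prob PX (traj X 1 n a) = cprob PY (traj Y 1 n a) (in_Delta Y n)) <->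
    \prod_(2 <= r < n) step_weight p q r a =
     (\prod_(2 <= r < n) if a r then ratio theta r else 1) / G theta n.-1.
  move=> an; rewrite (cprob_traj htheta hY) //.
  by rewrite (prob_derangement_traj hp2 hp hq n2 hX).
have Gn : G theta n.-1 != 0.
  by case: n hn {words itv n2 hX} => [|[|m]] // _; rewrite gt_eqF // G_pos.
tfae.
- move=> I i; rewrite -itv => ilt; rewrite gamma_quot; last by lia.
  split=> //.
  apply: (G_quot_of_ratio hp2 hp hq htheta (n := n)); last by lia.
  apply: (ratio_of_words hp2 hp Gn) => a an.
  by apply/words => //; apply: I.
- move=> II i; rewrite -itv => ilt; apply/thetaE; first by lia.
  apply: (ratio_of_G_quot hp2 hq htheta (n := n)) => // k; rewrite itv => kn.
  by have [-> ->] := II k kn.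
- move=> III a an; apply/words => //.
  apply: (words_of_G_quot hp2 hp hq htheta) => //.
  apply: (G_quot_of_ratio hp2 hp hq htheta) => i ilt.
  by apply/thetaE; [lia|apply: III; rewrite -itv].
Qed.
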